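(* Let $\lambda\vdash n$ and $M\in\operatorname{SSYT}(\lambda)$. Then $\{F_{M,T}:T\in\operatorname{SYT}(\lambda)\}$ is a basis of $V_M$. Moreover, $V_M$ is an irreducible representation of $S_n$ on a subspace of $\mathbb{Q}[x_1,\ldots,x_n]$ that is homogeneous of degree $\Sigma(M)$, and it is isomorphic to the Specht module $\mathcal{S}^\lambda$.
   Context: $S_n$ acts on $\mathbb{Q}[x_1,\ldots,x_n]$ by $\sigma\cdot x_i=x_{\sigma(i)}$. $\operatorname{SSYT}(\lambda)$ consists of the semistandard fillings of $\lambda$ by non-negative integers, and $\Sigma(M)$ is the entry sum. $\operatorname{SYT}(\lambda)$ is the set of standard Young tableaux. For a filling $T$ of $\lambda$ by $1,\ldots,n$, each used once, $R(T)$ and $C(T)$ are the row and column stabilizers, and $\varepsilon_T=\sum_{\sigma\in C(T)}\sum_{\tau\in R(T)}\operatorname{sgn}(\sigma)\sigma\tau$. $p_{M,T}=\prod x_i^{h_i}$, where $h_i$ is the entry of $M$ in the box of $T$ containing $i$. $s_{M,T}$ is the order of the stabilizer of $p_{M,T}$ in $R(T)$, and $F_{M,T}=\varepsilon_Tp_{M,T}/s_{M,T}$. $V_M$ is the $\mathbb{Q}$-span of $F_{M,T}$ over all such fillings $T$. *)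

(* Defs.v *)
From mathcomp Require Import all_boot all_order all_algebra all_fingroup.
From mathcomp Require Import mpoly.

Set Implicit Arguments.
Unset Strict Implicit.
Unset Printing Implicit Defensive.

Import GRing.Theory.
Local Open Scope ring_scope.

Definition is_partition (n : nat) (la : seq nat) : bool :=
  [&& sorted geq la, 0%N \notin la & sumn la == n].

(* The boxes (i, j) of the Young diagram: i < size la and j < la_i. *)
Definition box (la : seq nat) : finType :=
  {i : 'I_(size la) & 'I_(nth 0%N la i)}.

Definition row (la : seq nat) (b : box la) : 'I_(size la) := tag b.
Definition col (la : seq nat) (b : box la) : nat := tagged b.

Definition is_ssyt (la : seq nat) (M : {ffun box la -> nat}) : bool :=
  [forall b : box la, forall c : box la,
     ((row b == row c) && (col b < col c)%N ==> (M b <= M c)%N)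
     && ((col b == col c) && (row b < row c)%N ==> (M b < M c)%N)].

Definition entry_sum (la : seq nat) (M : {ffun box la -> nat}) : nat :=
  (\sum_(b : box la) M b)%N.

(* The numbers 1, ..., n are represented by the elements 0, ..., n - 1 of 'I_n,
   as are the indices of the variables x_1, ..., x_n. *)
Definition fillings (n : nat) (la : seq nat) : {set {ffun box la -> 'I_n}} :=
  [set T : {ffun box la -> 'I_n} |
    [forall i : 'I_n, #|[set b | T b == i]| == 1%N]].

Definition SYT (n : nat) (la : seq nat) : {set {ffun box la -> 'I_n}} :=
  [set T in fillings n la |
    [forall b : box la, forall c : box la,
       ((row b == row c) && (col b < col c)%N ==> (T b < T c)%N)
       && ((col b == col c) && (row b < row c)%N ==> (T b < T c)%N)]].

Section Tableau.

Variables (n : nat) (la : seq nat).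
Implicit Types (T : {ffun box la -> 'I_n}) (M : {ffun box la -> nat}).

Definition row_set T (i : 'I_(size la)) : {set 'I_n} :=
  [set T b | b in [pred b | row b == i]].

Definition col_set T (j : nat) : {set 'I_n} :=
  [set T b | b in [pred b | col b == j]].

Definition row_stab T : {set 'S_n} :=
  [set s : 'S_n | [forall i, s @: row_set T i == row_set T i]].

(* Column indices of boxes are smaller than [sumn la]. *)
Definition col_stab T : {set 'S_n} :=
  [set s : 'S_n | [forall j : 'I_(sumn la), s @: col_set T j == col_set T j]].

(* [msym s] is the algebra morphism sending 'X_i to 'X_(s i).  The product
   "sigma tau" below applies tau first, whereas (s * t)%g applies s first. *)
Definition young_symmetrizer T (p : {mpoly rat[n]}) : {mpoly rat[n]} :=
  \sum_(s in col_stab T) \sum_(t in row_stab T)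
     (-1) ^+ s *: msym s (msym t p).

(* The product over i of x_i ^ h_i, reindexed by the box b containing i. *)
Definition pMT M T : {mpoly rat[n]} := \prod_(b : box la) 'X_(T b) ^+ M b.

Definition sMT M T : nat :=
  #|[set t in row_stab T | msym t (pMT M T) == pMT M T]|.

Definition FMT M T : {mpoly rat[n]} :=
  (sMT M T)%:R^-1 *: young_symmetrizer T (pMT M T).

End Tableau.

Definition span (V : lmodType rat) (I : finType) (A : {set I}) (f : I -> V) :
    V -> Prop :=
  fun v => exists c : I -> rat, v = \sum_(i in A) c i *: f i.

Definition is_basis (V : lmodType rat) (W : V -> Prop)
    (I : finType) (A : {set I}) (f : I -> V) : Prop :=
  (forall v, W v <-> span A f v)
  /\ (forall c : I -> rat,
        \sum_(i in A) c i *: f i = 0 -> forall i, i \in A -> c i = 0).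

Section Representation.

Variables (n : nat) (V : lmodType rat) (act : 'S_n -> V -> V).

Definition subrep (W : V -> Prop) : Prop :=
  [/\ W 0, forall (a : rat) (u v : V), W u -> W v -> W (a *: u + v)
    & forall (s : 'S_n) (v : V), W v -> W (act s v)].

Definition irreducible_rep (W : V -> Prop) : Prop :=
  [/\ subrep W, exists2 v, W v & v <> 0
    & forall U : V -> Prop, subrep U -> (forall v, U v -> W v) ->
        (forall v, U v -> v = 0) \/ (forall v, W v -> U v)].

End Representation.

Definition isomorphic_rep (n : nat)
    (V : lmodType rat) (act : 'S_n -> V -> V) (W : V -> Prop)
    (V' : lmodType rat) (act' : 'S_n -> V' -> V') (W' : V' -> Prop) : Prop :=
  exists f : V -> V',
    [/\ forall (a : rat) (u v : V), W u -> W v ->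
          f (a *: u + v) = a *: f u + f v,
        forall (s : 'S_n) (v : V), W v -> f (act s v) = act' s (f v),
        forall u v : V, W u -> W v -> f u = f v -> u = v
      & forall v' : V', W' v' <-> exists2 v, W v & f v = v'].

Definition VM (n : nat) (la : seq nat) (M : {ffun box la -> nat}) :
    {mpoly rat[n]} -> Prop :=
  span (fillings n la) (fun T => FMT M T).

Section Specht.

Variables (n : nat) (la : seq nat).

(* The tabloid {T}, i.e. the row-equivalence class of T, is encoded by its
   family of row sets.  Families that are not of this form are harmless: they
   do not occur in polytabloids. *)
Definition tabloid : finType := {ffun 'I_(size la) -> {set 'I_n}}.

Definition tabloid_of (T : {ffun box la -> 'I_n}) : tabloid :=
  [ffun i => row_set T i].

Definition tabloid_act (s : 'S_n) (t : tabloid) : tabloid :=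
  [ffun i => s @: t i].

(* A formal combination of tabloids is the function giving its coefficients. *)
Definition tabloid_module : lmodType rat := {ffun tabloid -> rat^o}.

Definition tabloid_vec (t : tabloid) : tabloid_module :=
  [ffun u => (u == t)%:R].

Definition tabloid_module_act (s : 'S_n) (v : tabloid_module) :
    tabloid_module :=
  [ffun u => v (tabloid_act s^-1%g u)].

Definition polytabloid (T : {ffun box la -> 'I_n}) : tabloid_module :=
  \sum_(s in col_stab T)
     (-1) ^+ s *: tabloid_module_act s (tabloid_vec (tabloid_of T)).

Definition Specht : tabloid_module -> Prop :=
  span (fillings n la) polytabloid.

End Specht.

(* Main.v *)
From Stdlib Require Import ClassicalEpsilon.
From HB Require Import structures.
From mathcomp Require Import all_boot all_order all_algebra all_fingroup.
From mathcomp Require Import mpoly.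
Require Import Defs.

Set Implicit Arguments.
Unset Strict Implicit.
Unset Printing Implicit Defensive.

Import Order.TTheory GRing.Theory Num.Theory.
Local Open Scope ring_scope.

(* Sending a combination of tabloids v to the sum of v({T}) p_{M,T} over all
   fillings T, divided by s_{M,T}, is an equivariant map from tabloids to
   polynomials that takes the polytabloid e_T to F_{M,T}; hence V_M is the image
   of the Specht module.  The coefficient of p_{M,T} in F_{M,T} is 1 because the
   columns of M are strictly increasing, so this map is nonzero on the Specht
   module, hence injective there since the Specht module is irreducible (James'
   argument).

   That the standard polytabloids form a basis is seen on leading terms.  Encode
   a tabloid as the word listing the row of each number, and compare words at
   their last difference.  The leading word of e_T for standard T is that of T.
   Conversely the leading word of any nonzero element of the Specht module is
   a ballot word, thus comes from a standard tableau: the operators moving one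
   entry up from row r' to row r < r' kill the Specht module, whereas they are
   injective on words in which r' is more frequent than r (the sl_2 identity
   EF - FE = H and positivity of the standard inner product). *)

(** * Boxes of a Young diagram and the lengths of its rows *)

Section Boxes.

Variable la : seq nat.
Implicit Types b c : box la.

Lemma box_inj b c : row b = row c -> col b = col c -> b = c.
Proof.
case: b c => [i j] [i' j']; rewrite /row /col /= => eq_i.
by case: i' / eq_i j' => j' /= /val_inj ->.
Qed.

Definition mkbox (i : 'I_(size la)) j (ltj : (j < nth 0%N la i)%N) : box la :=
  Tagged (fun i : 'I_(size la) => 'I_(nth 0%N la i)) (Ordinal ltj).

Lemma ltn_col b : (col b < nth 0%N la (row b))%N.
Proof. exact: ltn_ord. Qed.

Lemma ltn_col_sumn b : (col b < sumn la)%N.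
Proof.
apply: leq_trans (ltn_col b) _.
have lti := ltn_ord (row b).
rewrite -[la in sumn la](cat_take_drop (row b)) sumn_cat (drop_nth 0%N) //=.
by rewrite addnCA leq_addr.
Qed.

Lemma card_row_below (i : 'I_(size la)) m : (m <= nth 0 la i)%N ->
  #|[set b : box la | (row b == i) && (col b < m)%N]| = m.
Proof.
move=> lem; pose f (j : 'I_m) := mkbox (leq_trans (ltn_ord j) lem).
have f_inj : injective f.
  by move=> j k eqf; apply: val_inj; exact: (congr1 (@col la) eqf).
rewrite -[RHS]card_ord -(card_imset _ f_inj); apply: eq_card => b; rewrite inE.
apply/andP/imsetP => [[/eqP rb cb]|[j _ ->]]; last by rewrite /row /col /= eqxx.
by exists (Ordinal cb) => //; apply: box_inj.
Qed.

Lemma card_row (i : 'I_(size la)) : #|[set b : box la | row b == i]| =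
  nth 0%N la i.
Proof.
rewrite -[RHS](card_row_below (leqnn _)); apply: eq_card => b; rewrite !inE.
by case: eqP => //= <-; rewrite ltn_col.
Qed.

Lemma card_box : #|box la| = sumn la.
Proof.
rewrite -sum1_card (partition_big (@row la) predT) //=.
under eq_bigr => i _.
  rewrite sum1dep_card -/(row _) card_row; over.
by rewrite sumnE (big_nth 0%N) big_mkord.
Qed.

End Boxes.

(** * Fillings as bijections; their row and column stabilizers *)

Section Fillings.

Variables (n : nat) (la : seq nat).
Implicit Types (T : {ffun box la -> 'I_n}) (s t : 'S_n).

(** The inverse [g] sends a number to its box. Later arguments on rows and columns are phrased
    through [row (g x)] and [col (g x)], which avoids handling the row and column sets
    themselves. *)
Lemma fillings_cancel T : T \in fillings n la ->
  exists g, cancel T g /\ cancel g T.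
Proof.
rewrite inE => /forallP T1.
have ex x : exists b, [set b | T b == x] == [set b].
  by have /cards1P[b ->] := T1 x; exists b.
have gP x : T (xchoose (ex x)) = x.
  have /eqP/setP/(_ (xchoose (ex x))) := xchooseP (ex x).
  by rewrite !inE eqxx => /eqP.
exists (fun x => xchoose (ex x)); split=> // b.
have /eqP/setP/(_ b) := xchooseP (ex (T b)).
by rewrite !inE eqxx => /esym/eqP.
Qed.

Lemma bij_fillings T : bijective T -> T \in fillings n la.
Proof.
case=> g gT Tg; rewrite inE; apply/forallP => x; apply/cards1P; exists (g x).
by apply/setP => b; rewrite !inE (can2_eq gT Tg).
Qed.

Lemma fillings_exist : sumn la = n -> exists T, T \in fillings n la.
Proof.
rewrite -card_box => eqn.
exists [ffun b => cast_ord eqn (enum_rank b)]; apply: bij_fillings.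
exists (fun x => enum_val (cast_ord (esym eqn) x)) => [b|x].
  by rewrite ffunE cast_ordK enum_rankK.
by rewrite ffunE enum_valK cast_ordKV.
Qed.

Definition act_fill s T : {ffun box la -> 'I_n} := [ffun b => s (T b)].

Lemma act_fillM s t T : act_fill s (act_fill t T) = act_fill (t * s)%g T.
Proof. by apply/ffunP => b; rewrite !ffunE permM. Qed.

Lemma act_fill1 T : act_fill 1 T = T.
Proof. by apply/ffunP => b; rewrite !ffunE perm1. Qed.

Lemma act_fill_fillings s T : (act_fill s T \in fillings n la) =
  (T \in fillings n la).
Proof.
suff act_in u U : U \in fillings n la -> act_fill u U \in fillings n la.
  apply/idP/idP => [/(act_in s^-1%g)|/act_in //].
  by rewrite act_fillM mulgV act_fill1.
case/fillings_cancel => g [gU Ug]; apply: bij_fillings.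
exists (fun x => g (u^-1%g x)) => x; rewrite ffunE ?permK ?gU //.
by rewrite Ug permKV.
Qed.

Lemma act_fill_inj s : injective (act_fill s).
Proof.
move=> T U /(congr1 (act_fill s^-1%g)).
by rewrite !act_fillM mulgV !act_fill1.
Qed.

Lemma fillings_trans T U : T \in fillings n la -> U \in fillings n la ->
  exists s, U = act_fill s T.
Proof.
case/fillings_cancel => g [gT Tg] /fillings_cancel[h [hU Uh]].
have inj : injective (U \o g) by apply: inj_comp (can_inj hU) (can_inj Tg).
by exists (perm inj); apply/ffunP => b; rewrite ffunE permE /= gT.
Qed.

Lemma row_setE T g i x : cancel T g -> cancel g T -> (x \in row_set T i) =
  (row (g x) == i).
Proof.
move=> gT Tg; apply/imsetP/idP => [[b /[swap] ->]|rx]; first by rewrite gT inE.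
by exists (g x); rewrite ?inE ?Tg.
Qed.

Lemma col_setE T g j x : cancel T g -> cancel g T -> (x \in col_set T j) =
  (col (g x) == j).
Proof.
move=> gT Tg; apply/imsetP/idP => [[b /[swap] ->]|rx]; first by rewrite gT inE.
by exists (g x); rewrite ?inE ?Tg.
Qed.

Lemma imset_perm_eq s (A : {set 'I_n}) : (s @: A == A) =
  [forall x in A, s x \in A].
Proof.
apply/eqP/forall_inP => [sA x Ax|sA]; first by rewrite -sA imset_f.
apply/eqP; rewrite eqEcard card_imset ?leqnn ?andbT; last exact: perm_inj.
by apply/subsetP => _ /imsetP[x Ax ->]; apply: sA.
Qed.

Lemma row_stabP T g s : cancel T g -> cancel g T ->
  reflect (forall x, row (g (s x)) = row (g x)) (s \in row_stab T).
Proof.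
move=> gT Tg; rewrite inE; apply: (iffP forallP) => [sT x|sT i].
  have := sT (row (g x)); rewrite imset_perm_eq => /forall_inP/(_ x).
  by rewrite !(row_setE _ _ gT Tg) eqxx => /(_ isT)/eqP.
rewrite imset_perm_eq; apply/forall_inP => x.
by rewrite !(row_setE _ _ gT Tg) sT.
Qed.

Lemma col_stabP T g s : cancel T g -> cancel g T ->
  reflect (forall x, col (g (s x)) = col (g x)) (s \in col_stab T).
Proof.
move=> gT Tg; rewrite inE; apply: (iffP forallP) => [sT x|sT i].
  have := sT (Ordinal (ltn_col_sumn (g x))).
  rewrite imset_perm_eq => /forall_inP/(_ x).
  by rewrite !(col_setE _ _ gT Tg) eqxx => /(_ isT)/eqP.
rewrite imset_perm_eq; apply/forall_inP => x.
by rewrite !(col_setE _ _ gT Tg) sT.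
Qed.

Lemma col_stab1 T : 1%g \in col_stab T.
Proof.
by rewrite inE; apply/forallP => i; rewrite imset_perm_eq;
  apply/forall_inP => x; rewrite perm1.
Qed.

Lemma col_stabM T s t : s \in col_stab T -> (t * s \in col_stab T)%g =
  (t \in col_stab T).
Proof.
rewrite !inE => /forallP sC; apply: eq_forallb => i.
have imM u : ((u * s)%g @: col_set T i) = s @: (u @: col_set T i).
  by rewrite -imset_comp; apply: eq_imset => x /=; rewrite permM.
by rewrite imM -{2}(eqP (sC i)) (inj_eq (imset_inj (@perm_inj _ s))).
Qed.

Lemma col_stabMl T s t : s \in col_stab T -> (s * t \in col_stab T)%g =
  (t \in col_stab T).
Proof.
rewrite !inE => /forallP sC; apply: eq_forallb => i.
have imM u : ((s * u)%g @: col_set T i) = u @: (s @: col_set T i).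
  by rewrite -imset_comp; apply: eq_imset => x /=; rewrite permM.
by rewrite imM (eqP (sC i)).
Qed.

Lemma col_stabV T s : (s^-1%g \in col_stab T) = (s \in col_stab T).
Proof.
apply/idP/idP => sC; last by rewrite -(col_stabM _ sC) mulVg col_stab1.
by rewrite -(col_stabM _ sC) mulgV col_stab1.
Qed.

(** Since [*] applies its left factor first, [t ^ s] is the map $s\circ t\circ s^{-1}$, and it acts
    on the relabelled columns as [t] acts on the original ones. *)
Lemma col_stab_act s t T : (t ^ s \in col_stab (act_fill s T))%g =
  (t \in col_stab T).
Proof.
rewrite !inE; apply: eq_forallb => i.
have -> : col_set (act_fill s T) i = s @: col_set T i.
  by rewrite /col_set -imset_comp; apply: eq_imset => b; rewrite ffunE.
have -> : ((t ^ s)%g @: (s @: col_set T i)) = s @: (t @: col_set T i).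
  by rewrite -!imset_comp; apply: eq_imset => x /=; rewrite permJ.
by rewrite (inj_eq (imset_inj (@perm_inj _ s))).
Qed.

Lemma row_stab_act s t T : (t ^ s \in row_stab (act_fill s T))%g =
  (t \in row_stab T).
Proof.
rewrite !inE; apply: eq_forallb => i.
have -> : row_set (act_fill s T) i = s @: row_set T i.
  by rewrite /row_set -imset_comp; apply: eq_imset => b; rewrite ffunE.
have -> : ((t ^ s)%g @: (s @: row_set T i)) = s @: (t @: row_set T i).
  by rewrite -!imset_comp; apply: eq_imset => x /=; rewrite permJ.
by rewrite (inj_eq (imset_inj (@perm_inj _ s))).
Qed.

End Fillings.

(** * The tabloid module, polytabloids, and tabloids as words of rows *)

Section TabloidModule.

Variables (n : nat) (la : seq nat).
Implicit Types (T : {ffun box la -> 'I_n}) (s t : 'S_n) (u : tabloid n la).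
Implicit Types (v : tabloid_module n la).

Lemma tabloid_actM s t u :
  tabloid_act s (tabloid_act t u) = tabloid_act (t * s)%g u.
Proof.
apply/ffunP => i; rewrite !ffunE -imset_comp.
by apply: eq_imset => x /=; rewrite permM.
Qed.

Lemma tabloid_act1 u : tabloid_act 1%g u = u.
Proof.
apply/ffunP => i; rewrite ffunE -[RHS]imset_id.
by apply: eq_imset => x; rewrite perm1.
Qed.

Lemma tabloid_actK s : cancel (@tabloid_act n la s) (tabloid_act s^-1%g).
Proof. by move=> u; rewrite tabloid_actM mulgV tabloid_act1. Qed.

Lemma tabloid_actKV s : cancel (@tabloid_act n la s^-1%g) (tabloid_act s).
Proof. by move=> u; rewrite tabloid_actM mulVg tabloid_act1. Qed.

Lemma tabloid_of_act s T : tabloid_of (act_fill s T) =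
  tabloid_act s (tabloid_of T).
Proof.
apply/ffunP => i; rewrite !ffunE /row_set -imset_comp.
by apply: eq_imset => b; rewrite ffunE.
Qed.

Lemma tabloid_module_act_is_linear s : linear (@tabloid_module_act n la s).
Proof. by move=> a v w; apply/ffunP => u; rewrite !ffunE. Qed.

HB.instance Definition _ s :=
  GRing.isLinear.Build rat (tabloid_module n la) (tabloid_module n la) *:%R
    (@tabloid_module_act n la s) (tabloid_module_act_is_linear s).

Lemma tabloid_module_actM s t v :
  tabloid_module_act s (tabloid_module_act t v) =
    tabloid_module_act (t * s)%g v.
Proof. by apply/ffunP => u; rewrite !ffunE tabloid_actM invMg. Qed.

Lemma tabloid_module_act_vec s u :
  tabloid_module_act s (tabloid_vec u) = tabloid_vec (tabloid_act s u).
Proof.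
by apply/ffunP => u'; rewrite !ffunE (can2_eq (tabloid_actKV s) (@tabloid_actK
  s)).
Qed.

Lemma tabloid_vecE u u' : tabloid_vec u u' = (u' == u)%:R.
Proof. exact: ffunE. Qed.

(** James' signed column sum $\kappa_T$, extended to the whole module; [polytabloid T] is its value
    at the tabloid of [T]. *)
Definition col_antisym T v : tabloid_module n la :=
  \sum_(s in col_stab T) (-1) ^+ s *: tabloid_module_act s v.

Lemma col_antisym_is_linear T : linear (col_antisym T).
Proof.
move=> a v w; rewrite scaler_sumr -big_split /=; apply: eq_bigr => s _.
by rewrite linearP scalerDr !scalerA mulrC.
Qed.

HB.instance Definition _ T :=
  GRing.isLinear.Build rat (tabloid_module n la) (tabloid_module n la) *:%R
    (col_antisym T) (col_antisym_is_linear T).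

Lemma col_antisym_stab T s v : s \in col_stab T ->
  col_antisym T (tabloid_module_act s v) = (-1) ^+ s *: col_antisym T v.
Proof.
move=> sC; rewrite /col_antisym [in RHS](reindex_inj (mulgI s)) scaler_sumr /=.
apply: eq_big => [t|t tC]; first by rewrite col_stabMl.
by rewrite tabloid_module_actM scalerA odd_permM signr_addb signrMK.
Qed.

(** A transposition in $C(T)$ changes the sign of the column sum, so if it fixes [v] the sum equals
    its own negative. *)
Lemma col_antisym_tperm T v x y : x != y -> tperm x y \in col_stab T ->
  tabloid_module_act (tperm x y) v = v -> col_antisym T v = 0.
Proof.
move=> neq tC fix_v; have := col_antisym_stab v tC.
rewrite fix_v odd_tperm neq expr1 scaleN1r => /eqP.
by rewrite -addr_eq0 -mulr2n -scaler_nat scaler_eq0 pnatr_eq0 => /eqP.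
Qed.

Lemma polytabloid_act s T :
  polytabloid (act_fill s T) = tabloid_module_act s (polytabloid T).
Proof.
rewrite linear_sum /= {1}/polytabloid (reindex_inj (conjg_inj s)) /=.
apply: eq_big => [t|t tC]; first by rewrite col_stab_act.
rewrite odd_permJ linearZ /= tabloid_of_act -!tabloid_module_act_vec.
by rewrite !tabloid_module_actM conjgE !mulgA mulgV mul1g.
Qed.

Lemma polytabloidE T u :
  polytabloid T u =
    \sum_(s in col_stab T) (-1) ^+ s * (u == tabloid_act s (tabloid_of T))%:R.
Proof.
rewrite sum_ffunE; apply: eq_bigr => s _.
by rewrite tabloid_module_act_vec !ffunE.
Qed.

(** The row sets of a filling partition the numbers, so a genuine tabloid amounts to the word giving
    the row of each number. Words can be compared letter by letter. *)
Definition word_tabloid (w : {ffun 'I_n -> 'I_(size la)}) : tabloid n la :=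
  [ffun i => [set x | w x == i]].

Lemma word_tabloid_inj : injective word_tabloid.
Proof.
move=> w w' /ffunP eqw; apply/ffunP => x; have /setP/(_ x) := eqw (w x).
by rewrite !ffunE !inE eqxx => /esym/eqP.
Qed.

Lemma tabloid_ofE T g : cancel T g -> cancel g T ->
  tabloid_of T = word_tabloid [ffun x => row (g x)].
Proof.
move=> gT Tg; apply/ffunP => i; rewrite !ffunE; apply/setP => x.
by rewrite (row_setE _ _ gT Tg) inE ffunE.
Qed.

Lemma tabloid_act_word s w :
  tabloid_act s (word_tabloid w) = word_tabloid [ffun x => w (s^-1%g x)].
Proof.
apply/ffunP => i; rewrite !ffunE; apply/setP => x.
rewrite inE ffunE -{1}[x](permKV s) mem_imset ?inE //; exact: perm_inj.
Qed.

Lemma polytabloid_word T g w : cancel T g -> cancel g T ->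
  polytabloid T (word_tabloid w) =
    \sum_(s in col_stab T) (-1) ^+ s * [forall x, w (s x) == row (g x)]%:R.
Proof.
move=> gT Tg; rewrite polytabloidE; apply: eq_bigr => s _.
congr (_ * (nat_of_bool _)%:R).
rewrite (tabloid_ofE gT Tg) tabloid_act_word (inj_eq word_tabloid_inj).
apply/eqP/forallP => [-> x|eqw]; first by rewrite !ffunE permK.
by apply/ffunP => x; rewrite !ffunE -(eqP (eqw _)) permKV.
Qed.

(** This disposes of the families of sets that are not tabloids: an element of the Specht module is
    determined by its coefficients on words. *)
Lemma Specht_supp v u : Specht v -> v u != 0 ->
  exists2 T, T \in fillings n la & u = tabloid_of T.
Proof.
case=> c ->; rewrite sum_ffunE => nz; have: exists2 T, T \in fillings n la &
  polytabloid T u != 0.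
  apply/exists_inP; apply: contraR nz; rewrite negb_exists_in => /forall_inP z.
  by rewrite big1 // => T TF; have:= z T TF; rewrite ffunE negbK => /eqP->;
    rewrite scaler0.
case=> T TF; rewrite polytabloidE => nz2.
have: [exists s : 'S_n, u == tabloid_act s (tabloid_of T)].
  apply: contraR nz2; rewrite negb_exists => /forallP z.
  by rewrite big1 // => s _; rewrite (negPf (z s)) mulr0.
case/existsP=> s /eqP->; exists (act_fill s T); first
  by rewrite act_fill_fillings.
by rewrite tabloid_of_act.
Qed.

End TabloidModule.

(** * Linear spans, and a counting argument on columns *)

Section Span.

Variables (V : lmodType rat) (I : finType) (A : {set I}) (f : I -> V).

Lemma span_linear a u v : Defs.span A f u -> Defs.span A f v ->
  Defs.span A f (a *: u + v).
Proof.
case=> c -> [d ->]; exists (fun i => a * c i + d i).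
rewrite scaler_sumr -big_split /=; apply: eq_bigr => i _.
by rewrite scalerDl scalerA.
Qed.

Lemma span0 : Defs.span A f 0.
Proof. by exists (fun=> 0); rewrite big1 // => i _; rewrite scale0r. Qed.

Lemma mem_span i : i \in A -> Defs.span A f (f i).
Proof.
move=> Ai; exists (fun j => (j == i)%:R); rewrite (bigD1 i) //= eqxx scale1r.
by rewrite big1 ?addr0 // => j /andP[_ /negPf->]; rewrite scale0r.
Qed.

Lemma span_ind (W : V -> Prop) : W 0 ->
    (forall a u v, W u -> W v -> W (a *: u + v)) ->
  (forall i, i \in A -> W (f i)) -> forall v, Defs.span A f v -> W v.
Proof.
move=> W0 Wlin Wf _ [c ->]; apply: (big_ind W) => // [u v Wu Wv|i Ai].
  by rewrite -[u]scale1r; apply: Wlin.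
by rewrite -[_ *: _]addr0; apply: Wlin => //; apply: Wf.
Qed.

End Span.

(** Put $m=\lambda_{\rho(b)}$ and count the boxes in columns below $m$ by their value under [rho].
    The fiber over $i$ contains at most $\min(m,\lambda_i)$ of them, and these bounds add up to the
    total, as the fibers of [row] show. Hence all bounds are attained, and the whole fiber over
    [rho b] lies in columns below $m$. *)
Lemma col_ltn_fiber (la : seq nat) (rho : box la -> 'I_(size la)) :
    (forall i, #|[set b | rho b == i]| = nth 0%N la i) ->
    (forall b c, col b = col c -> rho b = rho c -> b = c) ->
  forall b, (col b < nth 0%N la (rho b))%N.
Proof.
move=> card_rho rho_inj b; set m := nth 0%N la (rho b).
pose below (r : box la -> 'I_(size la)) i := [set c | (r c == i) && (col c <
  m)%N].
have sum_below r : (\sum_i #|below r i| = #|[set c :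
  box la | (col c < m)%N]|)%N.
  rewrite -[RHS]sum1dep_card (partition_big r predT) //=.
  by apply: eq_bigr => i _; rewrite -sum1dep_card; apply: eq_bigl => c;
    rewrite andbC.
have below_inj (r : box la -> 'I_(size la)) i :
  (forall b c, col b = col c -> r b = r c -> b = c) -> (#|below r i| <= m)%N.
  move=> r_inj; rewrite -[m]card_ord.
  case: (posnP m) => [m0|m_gt0].
    by rewrite eq_card0 // => c; rewrite inE m0 ltn0 andbF.
  (* The default [Ordinal m_gt0] is never reached on [below r i], where all columns are below
     [m]. *)
  pose f (c : box la) : 'I_m := insubd (Ordinal m_gt0) (col c).
  rewrite -(card_in_imset (f := f)) ?max_card // => c d.
  rewrite !inE => /andP[/eqP rc ltc] /andP[/eqP rd ltd] /(congr1 val).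
  by rewrite !val_insubd ltc ltd => /r_inj; apply; rewrite rc.
have le_below i : true -> (#|below rho i| <= #|below (@row la) i| ?= iff
    (#|below rho i| == #|below (@row la) i|))%N.
  move=> _; split=> //; have [le_m|lt_m] := leqP m (nth 0%N la i).
    by rewrite {2}/below (card_row_below le_m); exact: below_inj.
  have -> : below (@row la) i = [set c | row c == i].
    apply/setP => c; rewrite !inE; case: eqP => //= eqi.
    by rewrite (leq_trans (ltn_col c)) // eqi ltnW.
  rewrite card_row -card_rho subset_leq_card //.
  by apply/subsetP => c; rewrite !inE => /andP[].
(* Both families of fibers partition the same set of boxes, so the termwise inequalities are
   equalities. *)
have [_] := leqif_sum le_below.
rewrite !sum_below eqxx => /esym/forallP/(_ (rho b)) /eqP eqb.
have sub : below rho (rho b) \subset [set c | rho c == rho b].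
  by apply/subsetP => c; rewrite !inE => /andP[].
have eqs : below rho (rho b) = [set c | rho c == rho b].
  apply/eqP; rewrite eqEcard sub card_rho eqb.
  have -> : below (@row la) (rho b) = [set c | row c == rho b].
    by apply/setP => c; rewrite !inE; case: eqP => //= eqi;
      rewrite /m -eqi ltn_col.
  by rewrite card_row leqnn.
by have /setP/(_ b) := eqs; rewrite !inE eqxx.
Qed.

(** * Irreducibility of the Specht module by James' argument *)

Section Irreducible.

Variables (n : nat) (la : seq nat).
Implicit Types (T U : {ffun box la -> 'I_n}) (s t : 'S_n).
Implicit Types (v w : tabloid_module n la).

(** If two numbers share a column of [T] and a row of [U], their transposition makes the column sum
    vanish. Otherwise the numbers can be permuted within the columns of [T] so that each reaches its
    row in [U]; then the tabloid of [U] is a $C(T)$-translate of that of [T], and only a sign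
    appears. *)
Lemma col_antisym_tabloid T U : T \in fillings n la -> U \in fillings n la ->
  exists a, col_antisym T (tabloid_vec (tabloid_of U)) = a *: polytabloid T.
Proof.
case/fillings_cancel=> g [gT Tg] /fillings_cancel[h [hU Uh]].
have [/existsP[x /existsP[y /and3P[neq /eqP eq_col /eqP eq_row]]]|no_pair] :=
  boolP [exists x, exists y, [&& x != y, col (g x) == col (g y) & row (h x) ==
    row (h y)]].
  exists 0; rewrite scale0r; apply: (col_antisym_tperm neq).
    by apply/(col_stabP _ gT Tg) => z; case: tpermP => // ->.
  rewrite tabloid_module_act_vec (tabloid_ofE hU Uh) tabloid_act_word.
  congr (tabloid_vec (word_tabloid _)); apply/ffunP => z.
  by rewrite !ffunE tpermV; case: tpermP => // ->.
pose rho b := row (h (T b)).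
have rho_inj b c : col b = col c -> rho b = rho c -> b = c.
  move=> eq_col eq_row; apply: (can_inj gT); apply/eqP; apply:
    contraNT no_pair => neq.
  by apply/existsP; exists (T b); apply/existsP; exists (T c);
    rewrite neq !gT eq_col eqxx; apply/eqP.
have card_rho i : #|[set b | rho b == i]| = nth 0%N la i.
  rewrite -card_row.
  have inj : injective (h \o T) by apply: inj_comp (can_inj Uh) (can_inj gT).
  rewrite -[LHS](card_imset _ inj); apply: eq_card => c; rewrite !inE.
  apply/imsetP/eqP => [[b /[swap] ->]|rc]; first by rewrite inE => /eqP.
  by exists (g (U c)); rewrite ?inE /rho /= Tg hU // rc.
have lt_col := col_ltn_fiber card_rho rho_inj.
(* [f x] is the entry of [T] in the column where [T] has [x] and the row where [U] has [x]; this box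
   exists by [lt_col]. *)
pose f x := T (mkbox (lt_col (g x))).
have gf x : g (f x) = mkbox (lt_col (g x)) by rewrite /f gT.
have f_inj : injective f.
  move=> x y /(congr1 g); rewrite !gf => eqf.
  apply: (can_inj Tg); apply: rho_inj.
    exact: (congr1 (@col la) eqf).
  exact: (congr1 (@row la) eqf).
have fC : perm f_inj \in col_stab T.
  by apply/(col_stabP _ gT Tg) => x; rewrite permE gf.
exists ((-1) ^+ (perm f_inj)^-1%g).
rewrite -col_antisym_stab ?col_stabV // tabloid_module_act_vec (tabloid_ofE hU
  Uh).
rewrite (tabloid_ofE gT Tg) tabloid_act_word invgK.
congr (col_antisym T (tabloid_vec (word_tabloid _))); apply/ffunP => x.
by rewrite !ffunE permE gf /rho /row /= Tg.
Qed.

Lemma col_antisym_Specht T v : T \in fillings n la -> Specht v ->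
  exists a, col_antisym T v = a *: polytabloid T.
Proof.
move=> TF; elim/span_ind => [|a u w [b eb] [c ec]|U UF].
- by exists 0; rewrite linear0 scale0r.
- by exists (a * b + c); rewrite linearP /= eb ec scalerA scalerDl.
rewrite linear_sum /=.
apply: (big_ind (fun w => exists a, w = a *: polytabloid T)).
- by exists 0; rewrite scale0r.
- by move=> _ _ [a ->] [b ->]; exists (a + b); rewrite scalerDl.
move=> s _; rewrite linearZ /= tabloid_module_act_vec -tabloid_of_act.
have [|a ->] := col_antisym_tabloid (U := act_fill s U) TF; first
  by rewrite act_fill_fillings.
by exists ((-1) ^+ s * a); rewrite scalerA.
Qed.

(** The column sum is self-adjoint for the standard inner product, because $C(T)$ is closed under
    inverses and inversion preserves signs. *)
Lemma polytabloid_pairing T v :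
  \sum_u v u * polytabloid T u = col_antisym T v (tabloid_of T).
Proof.
rewrite [RHS]sum_ffunE.
under eq_bigr => u _ do rewrite polytabloidE mulr_sumr.
rewrite exchange_big /= (reindex_inj invg_inj) /=.
apply: eq_big => [s|s _]; first by rewrite col_stabV.
rewrite (bigD1 (tabloid_act s^-1%g (tabloid_of T))) //= eqxx big1 =>
  [|u /negPf->]; last first.
  by rewrite !mulr0.
by rewrite addr0 mulr1 !ffunE odd_permV mulrC.
Qed.

Lemma Specht_subrep : subrep (@tabloid_module_act n la) (@Specht n la).
Proof.
split; [exact: span0 | by move=> a u v; apply: span_linear|].
move=> s v; elim/span_ind => [|a u w Su Sw|T TF].
- by rewrite linear0; apply: span0.
- by rewrite linearP; apply: span_linear.
by rewrite -polytabloid_act; apply: mem_span; rewrite act_fill_fillings.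
Qed.

(** By self-adjointness [v] is orthogonal to every polytabloid, hence to itself, and the standard
    form is positive definite over the rationals. *)
Lemma Specht_pairing_eq0 v : Specht v ->
  (forall T, T \in fillings n la -> col_antisym T v = 0) -> v = 0.
Proof.
move=> Sv v0.
have orth w : Specht w -> \sum_u v u * w u = 0.
  elim/span_ind => [|a w1 w2 w10 w20|T TF].
  - by rewrite big1 // => u _; rewrite ffunE mulr0.
  - under eq_bigr => u _ do rewrite !ffunE mulrDr mulrCA.
    by rewrite big_split /= -mulr_sumr w10 w20 mulr0 addr0.
  by rewrite polytabloid_pairing v0 // ffunE.
apply/ffunP => u; rewrite ffunE; have /eqP := orth v Sv.
rewrite psumr_eq0 => [/allP/(_ u)|i _]; last by rewrite -expr2 sqr_ge0.
by rewrite mem_index_enum mulf_eq0 orbb => /(_ isT)/eqP.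
Qed.

(** If some column sum does not kill [W], it produces a nonzero multiple of a polytabloid in [W],
    whose translates span the Specht module. If all column sums kill [W], positivity forces [W] to
    be zero. *)
Lemma Specht_subrep_dichotomy (W : tabloid_module n la -> Prop) :
    subrep (@tabloid_module_act n la) W -> (forall v, W v -> Specht v) ->
  (forall v, W v -> v = 0) \/ (forall v, Specht v -> W v).
Proof.
case=> W0 Wlin Wact WS.
have WZ a v : W v -> W (a *: v) by move=> /Wlin/(_ W0); rewrite -[_ *:
  v in X in _ -> X]addr0; apply.
(* [W] is an arbitrary predicate, so this case distinction is classical. *)
have [[T [TF [v [Wv nz]]]]|none] := excluded_middle_informative
  (exists T, T \in fillings n la /\ exists v, W v /\ col_antisym T v <> 0);
    [right|left].
  have [a eqa] := col_antisym_Specht TF (WS v Wv).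
  have a_nz : a != 0 by apply: contra_not_neq nz => a0; rewrite eqa a0 scale0r.
  have WT : W (polytabloid T).
    rewrite -[polytabloid T](scalerK a_nz) -eqa; apply: (WZ).
    apply: (big_ind W) => // [u w Wu Ww|s _]; last by apply: WZ; apply: Wact.
    by rewrite -[u]scale1r; apply: Wlin.
  move=> w; elim/span_ind => // U UF; have [s ->] := fillings_trans TF UF.
  by rewrite polytabloid_act; apply: Wact.
move=> v Wv; apply: Specht_pairing_eq0 (WS v Wv) _ => T TF.
by apply/eqP/negP => /negP nz; apply: none; exists T; split=> //; exists v;
  split=> //; apply/eqP.
Qed.

End Irreducible.

(** * The equivariant map from tabloids to polynomials *)

Lemma mpolyX_inj n : injective (fun m : 'X_{1..n} => 'X_[m] : {mpoly rat[n]}).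
Proof.
move=> a b /(congr1 (mcoeff a)); rewrite !mcoeffX eqxx.
by have [->|_ /eqP] := eqVneq b a; rewrite ?oner_eq0.
Qed.

Section Polynomials.

Variables (n : nat) (la : seq nat) (M : {ffun box la -> nat}).
Implicit Types (T U : {ffun box la -> 'I_n}) (s t : 'S_n).
Implicit Types (v w : tabloid_module n la).

Lemma msym_pMT s T : msym s (pMT M T) = pMT M (act_fill s T).
Proof.
rewrite rmorph_prod; apply: eq_bigr => b _; rewrite rmorphXn ffunE;
  congr (_ ^+ _).
by rewrite /= /msym mmapX mmap1U.
Qed.

Lemma pMTE T g : cancel T g -> cancel g T ->
  pMT M T = 'X_[[multinom M (g x) | x < n]].
Proof.
move=> gT Tg; rewrite mpolyXE_id (reindex T) /=; last by exists g => x _.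
by apply: eq_bigr => b _; rewrite mnmE gT.
Qed.

Lemma pMT_homog T : T \in fillings n la -> pMT M T \is (entry_sum M).-homog.
Proof.
case/fillings_cancel=> g [gT Tg]; rewrite (pMTE gT Tg) dhomogX /= mdegE.
apply/eqP; rewrite /= (reindex T) /=; last by exists g => x _.
by apply: eq_bigr => b _; rewrite mnmE gT.
Qed.

(** Conjugation by [s] carries one stabilizer to the other. Hence a single scalar normalizes the map
    from tabloids to polynomials for all fillings at once. *)
Lemma sMT_act s T : sMT M (act_fill s T) = sMT M T.
Proof.
rewrite /sMT -[RHS](card_imset _ (conjg_inj s)); apply: eq_card => t.
rewrite -[t](conjgKV s) (mem_imset _ _ (conjg_inj s)) !inE -!msym_pMT.
set t' := (t ^ _)%g; rewrite -msymMm -conjgC msymMm.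
rewrite (inj_eq (@inj_msym _ _ s)); congr (_ && _).
by have := row_stab_act s t' T; rewrite !inE.
Qed.

(** The sum runs over fillings rather than tabloids, so that a tabloid is sent to a row
    symmetrization; [a] is to be $1/s_{M,T}$. *)
Definition specht_to_poly (a : rat) v : {mpoly rat[n]} :=
  a *: \sum_(T in fillings n la) v (tabloid_of T) *: pMT M T.

Lemma specht_to_poly_is_linear a : linear (specht_to_poly a).
Proof.
move=> b v w; rewrite /specht_to_poly scalerA [b * a]mulrC -scalerA -scalerDr.
congr (_ *: _); rewrite scaler_sumr -big_split /=; apply: eq_bigr => T _;
  rewrite !ffunE scalerDl.
by rewrite scalerA.
Qed.

HB.instance Definition _ a :=
  GRing.isLinear.Build rat (tabloid_module n la) {mpoly rat[n]} *:%R
    (specht_to_poly a) (specht_to_poly_is_linear a).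

Lemma specht_to_poly_act a s v :
  specht_to_poly a (tabloid_module_act s v) = msym s (specht_to_poly a v).
Proof.
rewrite linearZ linear_sum /= /specht_to_poly (reindex_inj (@act_fill_inj _ _
  s)) /=.
congr (_ *: _); apply: eq_big => [T|T _]; first by rewrite act_fill_fillings.
by rewrite ffunE tabloid_of_act tabloid_actK linearZ /= msym_pMT.
Qed.

(** The fillings row-equivalent to [T] are the translates of [T] by $R(T)$, each obtained once. *)
Lemma specht_to_poly_tabloid a T : T \in fillings n la ->
  specht_to_poly a (tabloid_vec (tabloid_of T)) =
    a *: \sum_(t in row_stab T) msym t (pMT M T).
Proof.
move=> TF; have [g [gT Tg]] := fillings_cancel TF; congr (_ *: _).
rewrite [RHS](eq_bigr (fun t => pMT M (act_fill t T))); last first.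
  by move=> t _; rewrite msym_pMT.
under [LHS]eq_bigr => U _ do rewrite tabloid_vecE.
rewrite (bigID (fun U => tabloid_of U == tabloid_of T)) /= addrC big1 ?add0r;
  last first.
  by move=> U /andP[_ /negPf->]; rewrite scale0r.
have act_inj : injective (fun t => act_fill t T).
  move=> s t eqs; apply/permP => x; rewrite -[x]Tg.
  by move/ffunP/(_ (g x)): eqs; rewrite !ffunE.
rewrite -(big_imset (fun U => pMT M U)) /=; last by move=> s t _ _; apply:
  act_inj.
apply: eq_big => [U|U /andP[_ /eqP->]]; last by rewrite eqxx scale1r.
apply/andP/imsetP => [[UF /eqP eqU]|[t tR ->]].
  have [t eqt] := fillings_trans TF UF; exists t => //; move: eqU.
  rewrite eqt tabloid_of_act => /ffunP eqU; rewrite inE; apply/forallP => i.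
  by have := eqU i; rewrite !ffunE => ->.
rewrite act_fill_fillings; split=> //; rewrite tabloid_of_act;
  apply/eqP/ffunP => i.
by move: tR; rewrite inE !ffunE => /forallP/(_ i)/eqP.
Qed.

Lemma specht_to_poly_polytabloid T : T \in fillings n la ->
  specht_to_poly (sMT M T)%:R^-1 (polytabloid T) = FMT M T.
Proof.
move=> TF; rewrite linear_sum /= /FMT /young_symmetrizer scaler_sumr.
apply: eq_bigr => s sC; rewrite linearZ /= specht_to_poly_act
  specht_to_poly_tabloid //.
rewrite msymZ (raddf_sum (msym s)) /= scalerA mulrC -scalerA; congr (_ *: _).
by rewrite scaler_sumr.
Qed.

(** Induction on the row: if [c] fixes all higher rows, injectivity prevents it from moving a box of
    the current row upwards. So [c] can only increase [M] there, strictly if the box moves, by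
    strictness of columns. But [M] has the same sum over the row after applying [c] as after
    applying [a], which permutes the row; hence nothing moves. *)
Lemma col_row_perm_id (a c : box la -> box la) : is_ssyt M ->
    injective a -> injective c -> (forall b, row (a b) = row b) ->
    (forall b, col (c b) = col b) -> (forall b, M (a b) = M (c b)) ->
  forall b, c b = b.
Proof.
move=> hM a_inj c_inj row_a col_c eqM b.
have [r ltr] := ubnP (row b : nat); elim: r => // r IH in b ltr *.
have {}IH b' : (row b' < row b)%N -> c b' = b' by move=> lt; apply: IH;
  apply: leq_trans lt _.
have row_c b' : row b' = row b -> (row b' <= row (c b'))%N.
  move=> eqr; rewrite leqNgt eqr; apply/negP => lt.
  by have := IH _ lt => /c_inj eqb; move: lt; rewrite eqb eqr ltnn.
have le_M b' : row b' == row b -> (M b' <= M (c b') ?= iff (c b' == b'))%N.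
  move=> /eqP eqr; have := row_c b' eqr; rewrite leq_eqVlt =>
    /orP[/eqP eqrc|ltrc].
    have -> : c b' = b' by apply: box_inj => //; apply: val_inj;
      rewrite /= eqrc.
    by split; rewrite ?eqxx.
  have := hM => /forallP/(_ b')/forallP/(_ (c b'))/andP[_].
  rewrite col_c eqxx ltrc /= => ltM; split; first exact: ltnW.
  rewrite (ltn_eqF ltM); apply/esym/negP => /eqP eqc.
  by move: ltM; rewrite eqc ltnn.
have [_] := leqif_sum le_M.
have -> : (\sum_(b' | row b' == row b) M (c b') =
  \sum_(b' | row b' == row b) M b')%N.
  rewrite [RHS](reindex_inj a_inj) /=; apply: eq_big => [b'|b' _]; last
    by rewrite eqM.
  by rewrite row_a.
by rewrite eqxx => /esym/forall_inP/(_ b)/(_ (eqxx _))/eqP.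
Qed.

(* The coefficient of [pMT M T] in [FMT M T] is 1. *)
Lemma FMT_neq0 T : is_ssyt M -> T \in fillings n la -> FMT M T != 0.
Proof.
move=> hM TF; have [g [gT Tg]] := fillings_cancel TF.
pose m := [multinom M (g x) | x < n].
have coef s t : s \in col_stab T -> t \in row_stab T ->
    (msym s (msym t (pMT M T)))@_m = ((s == 1%g) && (msym t (pMT M T) == pMT M
      T))%:R.
  move=> /(col_stabP _ gT Tg) sC /(row_stabP _ gT Tg) tR.
  have coefE u : (msym u (pMT M T))@_m = (msym u (pMT M T) == pMT M T)%:R.
    rewrite (pMTE gT Tg) msymX mcoeffX; congr (nat_of_bool _)%:R.
    by rewrite (inj_eq (@mpolyX_inj n)).
  have [->|s1] /= := eqVneq s 1%g; first by rewrite msym1m coefE.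
  rewrite -msymMm coefE; case: eqP => // eqp; case/negP: s1;
    apply/eqP/permP => x.
  have eqm y : M (g (t^-1%g (s^-1%g y))) = M (g y).
    move: eqp; rewrite (pMTE gT Tg) msymX => /mpolyX_inj/mnmP/(_ y).
    by rewrite !mnmE invMg permM.
  (* In terms of boxes, [t^-1] preserves rows and [s] preserves columns; [eqm] at [s (T b)] says
     that both give the same value of [M]. *)
  have := @col_row_perm_id (fun b => g (t^-1%g (T b))) (fun b =>
    g (s (T b))) hM.
  have tR' y : row (g (t^-1%g y)) = row (g y) by rewrite -{2}[y](permKV t) tR.
  move=> /(_ _ _ _ _ _ (g x)); rewrite Tg perm1 => H; apply: (can_inj Tg);
    apply: H.
  - by move=> b b' /(can_inj Tg)/perm_inj/(can_inj gT).
  - by move=> b b' /(can_inj Tg)/perm_inj/(can_inj gT).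
  - by move=> b; rewrite tR' gT.
  - by move=> b; rewrite sC gT.
  - by move=> b; rewrite -(eqm (s (T b))) permK.
have sMT_gt0 : (0 < sMT M T)%N.
  apply/card_gt0P; exists 1%g; rewrite inE msym1m eqxx andbT.
  by apply/(row_stabP _ gT Tg) => x; rewrite perm1.
apply/eqP => /(congr1 (mcoeff m)); rewrite mcoeff0 mcoeffZ /young_symmetrizer.
rewrite raddf_sum (bigD1 1%g) ?col_stab1 //= [X in _ + X]big1 =>
  [|s /andP[sC s1]]; last first.
  rewrite raddf_sum big1 // => t tR; rewrite /= mcoeffZ coef // (negPf s1) /=.
  by rewrite mulr0.
rewrite raddf_sum /= (eq_bigr (fun t => (msym t (pMT M T) == pMT M T)%:R)) =>
  [|t tR]; last first.
  by rewrite mcoeffZ coef ?col_stab1 // eqxx odd_perm1 mul1r.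
(* The surviving terms count the stabilizer of $p_{M,T}$ in $R(T)$, which cancels the factor
   $1/s_{M,T}$. *)
rewrite addr0 -natr_sum -big_mkcondr /= sum1_card.
have -> : #|[pred t in row_stab T | msym t (pMT M T) == pMT M T]| = sMT M T.
  by apply: eq_card => t; rewrite !inE.
by rewrite mulVf ?pnatr_eq0 -?lt0n // => /eqP; rewrite oner_eq0.
Qed.

End Polynomials.

(* For E f(B) = sum of f(B + x) and F f(C) = sum of f(C - x), the cross terms of
   |E f|^2 and |F f|^2 agree, so |E f|^2 - |F f|^2 is the sum over A of
   (|P & A| - |P - A|) f(A)^2: if E f = 0, it is both nonpositive and nonnegative. *)
Lemma up_operator_inj (I : finType) (P : {set I}) (f : {set I} -> rat) :
    (forall A, f A != 0 -> (#|P :\: A| < #|P :&: A|)%N) ->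
    (forall B, \sum_(x in P :\: B) f (x |: B) = 0) ->
  forall A, f A = 0.
Proof.
move=> maj up0.
(* The contributions of a single [x] to E and F, extended by zero so that all sums run over all
   sets. *)
pose up (x : I) (B : {set I}) : rat := if x \in B then 0 else f (x |: B).
pose dn (x : I) (C : {set I}) : rat := if x \in C then f (C :\ x) else 0.
have sqr_sum (h : I -> {set I} -> rat) :
    \sum_(x in P) \sum_(y in P) \sum_B h x B * h y B = \sum_B (\sum_(x in P) h x B) ^+ 2.
  under eq_bigr => x _ do rewrite exchange_big /=.
  rewrite exchange_big /=; apply: eq_bigr => B _; rewrite expr2 mulr_suml.
  by apply: eq_bigr => x _; rewrite mulr_sumr.
have cross x y : x != y -> \sum_B up x B * up y B = \sum_C dn x C * dn y C.
  move=> neq.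
  transitivity (\sum_(B : {set I} | (x \notin B) && (y \notin B))
    f (x |: B) * f (y |: B)).
    rewrite [RHS]big_mkcond; apply: eq_bigr => B _; rewrite /up.
    by case: (x \in B) (y \in B) => [] []; rewrite ?mul0r ?mulr0.
  transitivity (\sum_(C : {set I} | (x \in C) && (y \in C))
    f (C :\ x) * f (C :\ y)); last first.
    rewrite big_mkcond; apply: eq_bigr => B _; rewrite /dn.
    by case: (x \in B) (y \in B) => [] []; rewrite ?mul0r ?mulr0.
  (* Substituting $B=C\setminus\{x,y\}$ turns $B\cup\{x\}$ into $C\setminus\{y\}$ and $B\cup\{y\}$
     into $C\setminus\{x\}$. *)
  rewrite (reindex_onto (fun C : {set I} => C :\ x :\ y) (fun B => x |:
    (y |: B))) /=; last first.
    by move=> B /andP[xB yB]; rewrite setU1K ?setU1K // !inE (negPf neq).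
  apply: eq_big => [C|C /andP[_ /eqP eqC]].
    rewrite !inE !eqxx /= andbF /=.
    apply/eqP/andP => [<-|[xC yC]]; first by rewrite !inE !eqxx orbT.
    by rewrite (setD1K (a := y)) ?setD1K // !inE eq_sym neq.
  have xC : x \in C by rewrite -eqC !inE eqxx.
  have yC : y \in C by rewrite -eqC !inE eqxx orbT.
  rewrite mulrC; congr (f _ * f _).
    by rewrite setD1K // !inE eq_sym neq.
  by rewrite setDDl [[set x] :|: [set y]]setUC -setDDl setD1K // !inE neq.
have diag_up x : \sum_B up x B * up x B = \sum_(B : {set I} | x \in B) f B ^+ 2.
  transitivity (\sum_(B : {set I} | x \notin B) f (x |: B) ^+ 2).
    rewrite [RHS]big_mkcond; apply: eq_bigr => B _; rewrite /up.
    by case: (x \in B); rewrite ?mul0r ?expr2.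
  rewrite (reindex_onto (fun C : {set I} => C :\ x) (fun B => x |: B)) /=;
    last first.
    by move=> B xB; rewrite setU1K.
  apply: eq_big => [C|C /andP[_ /eqP->]] //.
  rewrite !inE eqxx /=; apply/eqP/idP => [<-|]; [exact: setU11 | exact: setD1K].
have diag_dn x : \sum_B dn x B * dn x B = \sum_(B :
  {set I} | x \notin B) f B ^+ 2.
  transitivity (\sum_(C : {set I} | x \in C) f (C :\ x) ^+ 2).
    rewrite [RHS]big_mkcond; apply: eq_bigr => B _; rewrite /dn.
    by case: (x \in B); rewrite ?mul0r ?expr2.
  rewrite (reindex_onto (fun C : {set I} => x |: C) (fun B => B :\ x)) /=;
    last first.
    by move=> B xB; rewrite setD1K.
  apply: eq_big => [C|C /andP[_ /eqP->]] //.
  rewrite !inE eqxx /=; apply/eqP/idP => [<-|];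
    [by rewrite !inE eqxx | exact: setU1K].
have sum_diag (Q : I -> pred {set I}) :
    \sum_(x in P) \sum_(B | Q x B) f B ^+ 2 =
      \sum_B #|[set x in P | Q x B]|%:R * f B ^+ 2.
  rewrite (exchange_big_dep predT) //=; apply: eq_bigr => B _.
  rewrite sumr_const -[LHS]mulr_natl; congr (_%:R * _).
  by apply: eq_card => x; rewrite !inE.
pose gap (B : {set I}) : rat := #|P :&: B|%:R - #|P :\: B|%:R.
have gap_ge0 B : 0 <= gap B * f B ^+ 2.
  have [->|/maj lt] := eqVneq (f B) 0; first by rewrite expr0n mulr0.
  by rewrite mulr_ge0 ?sqr_ge0 // subr_ge0 ler_nat ltnW.
have gap_eq0 : \sum_B gap B * f B ^+ 2 = 0.
  apply/eqP; rewrite eq_le sumr_ge0 ?andbT //.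
  have -> : \sum_B gap B * f B ^+ 2
      = \sum_B (\sum_(x in P) up x B) ^+ 2 - \sum_B (\sum_(x in P) dn x B) ^+ 2.
    rewrite -!sqr_sum -sumrB /=.
    transitivity (\sum_(x in P) ((\sum_(B : {set I} | x \in B) f B ^+ 2) -
      \sum_(B : {set I} | x \notin B) f B ^+ 2)).
      rewrite sumrB !sum_diag -sumrB; apply: eq_bigr => B _; rewrite -mulrBl.
      congr ((_%:R - _%:R) * _); apply: eq_card => x; rewrite !inE //.
      by rewrite andbC.
    apply: eq_bigr => x xP; rewrite [X in _ = X - _](bigD1 x) // [X in _ =
      _ - X](bigD1 x) //= diag_up diag_dn.
    rewrite [in RHS](eq_bigr (fun y => \sum_B dn x B * dn y B)).
      by rewrite opprD addrACA subrr addr0.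
    by move=> y /andP[_ neq]; rewrite cross // eq_sym.
  rewrite big1 => [|B _]; first by rewrite sub0r oppr_le0 sumr_ge0 // => B _;
    apply: sqr_ge0.
  apply/eqP; rewrite sqrf_eq0; apply/eqP; rewrite -[RHS](up0 B).
  rewrite big_mkcond [RHS]big_mkcond; apply: eq_bigr => x _; rewrite !inE /up.
  by case: (x \in B) (x \in P) => [] [].
move=> A; apply/eqP; apply: contraT => fA; have lt := maj A fA.
have /eqP := gap_eq0; rewrite psumr_eq0 // => /allP/(_ A).
rewrite mem_index_enum mulf_eq0 sqrf_eq0 (negPf fA) orbF => /(_ isT).
by rewrite subr_eq0 eqr_nat gtn_eqF.
Qed.

(** The digits of [a] below position $x$ contribute less than $K^x$, so the highest differing digit
    decides. *)
Lemma base_expansion_ltn (K : nat) (a b : nat -> nat) n x :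
    (forall y, a y < K)%N -> (x < n)%N -> (a x < b x)%N ->
    (forall y, x < y -> y < n -> a y = b y)%N ->
  (\sum_(y < n) a y * K ^ y < \sum_(y < n) b y * K ^ y)%N.
Proof.
move=> aK; have sum_lt m : (\sum_(y < m) a y * K ^ y < K ^ m)%N.
  elim: m => [|m IH]; first by rewrite big_ord0.
  rewrite big_ord_recr /= expnS; apply: (@leq_trans ((a m).+1 * K ^ m)).
    by rewrite mulSn ltn_add2r.
  by rewrite leq_mul2r aK orbT.
elim: n => // n IH; rewrite ltnS leq_eqVlt => /orP[/eqP-> lt _|ltx lt eqab].
  rewrite !big_ord_recr /=; apply: (@leq_trans ((a n).+1 * K ^ n)).
    by rewrite mulSn ltn_add2r sum_lt.
  by apply: leq_trans (leq_addl _ _); rewrite leq_mul2r lt orbT.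
rewrite !big_ord_recr /= eqab // ltn_add2r; apply: IH => // y ltxy lty.
by apply: eqab => //; apply: ltnW.
Qed.

(** * Leading words of polytabloids and of elements of the Specht module *)

Section LeadingWord.

Variables (n : nat) (la : seq nat).
Hypothesis la_part : is_partition n la.
Implicit Types (T U : {ffun box la -> 'I_n}) (s t : 'S_n).
Implicit Types (v : tabloid_module n la) (w z : {ffun 'I_n -> 'I_(size la)}).

(* Reading a word as an integer in base [(size la).+1] compares words by
   their last differing letter. *)
Definition word_rank w : nat := (\sum_(x < n) w x * (size la).+1 ^ x)%N.

Lemma word_rank_ltn w z (x : 'I_n) : (w x < z x)%N ->
  (forall y : 'I_n, (x < y)%N -> w y = z y) -> (word_rank w < word_rank z)%N.
Proof.
(* Positions beyond the word get the digit 0, which is below the base [(size la).+1] even for empty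
   [la]. *)
move=> lt eqwz; pose ext (u : {ffun 'I_n -> 'I_(size la)}) y :=
  oapp (fun i => u i : nat) 0%N (insub y).
have extE u (y : 'I_n) : ext u y = u y by rewrite /ext valK.
have rankE u : word_rank u = (\sum_(y < n) ext u y * (size la).+1 ^ y)%N.
  by apply: eq_bigr => y _; rewrite extE.
rewrite !rankE; apply: (base_expansion_ltn (x := x)) => //.
- by move=> y; rewrite /ext; case: insubP => //= i _ _; rewrite ltnS ltnW.
- by rewrite !extE.
by move=> y lty ltn; rewrite -[y]/(Ordinal ltn : nat) !extE eqwz.
Qed.

Lemma word_rank_inj : injective word_rank.
Proof.
move=> w z eqr; apply/eqP; apply: contraT => neq.
have /existsP[x0 neq0] : [exists x, w x != z x].
  apply: contraR neq; rewrite negb_exists => /forallP eqwz.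
  by apply/eqP/ffunP => x; apply/eqP; have := eqwz x; rewrite negbK.
(* [x] is the last position at which the two words differ. *)
case: (@arg_maxnP _ x0 (fun x => w x != z x) (fun x : 'I_n => x :
  nat) neq0) => x neqx max_x.
have eq_above (y : 'I_n) : (x < y)%N -> w y = z y.
  by move=> lt; apply/eqP; apply: contraLR lt; rewrite -leqNgt => /max_x.
have := neqx; rewrite neq_ltn => /orP[] lt.
  by have := word_rank_ltn lt eq_above; rewrite eqr ltnn.
by have := word_rank_ltn lt (fun y h => esym (eq_above y h)); rewrite eqr ltnn.
Qed.

Lemma SYT_fillings T : T \in SYT n la -> T \in fillings n la.
Proof. by rewrite inE => /andP[]. Qed.

Lemma SYT_row T b c : T \in SYT n la -> row b = row c -> (col b < col c)%N ->
  (T b < T c)%N.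
Proof.
rewrite inE => /andP[_ /forallP/(_ b)/forallP/(_ c)/andP[+ _]] eqr ltc.
by rewrite eqr eqxx ltc.
Qed.

Lemma SYT_col T b c : T \in SYT n la -> col b = col c -> (row b < row c)%N ->
  (T b < T c)%N.
Proof.
rewrite inE => /andP[_ /forallP/(_ b)/forallP/(_ c)/andP[_ +]] eqc ltr.
by rewrite eqc eqxx ltr.
Qed.

(** A column permutation that fixes the tabloid preserves both coordinates of every box, so only the
    identity contributes. *)
Lemma polytabloid_self T : T \in fillings n la ->
  polytabloid T (tabloid_of T) = 1.
Proof.
case/fillings_cancel=> g [gT Tg]; rewrite (tabloid_ofE gT Tg) (polytabloid_word
  _ gT Tg).
rewrite (bigD1 1%g) ?col_stab1 //= big1 => [|s /andP[sC s1]].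
  rewrite odd_perm1 mul1r addr0.
  by have -> : [forall x, [ffun x => row (g x)] ((1 : 'S_n)%g x) == row (g x)]
    by apply/forallP => x; rewrite perm1 ffunE.
case: forallP => [eqr|_]; last by rewrite mulr0.
case/negP: s1; apply/eqP/permP => x; rewrite perm1; apply: (can_inj Tg).
apply: box_inj; first by have /eqP := eqr x; rewrite ffunE.
by have /(col_stabP _ gT Tg)/(_ x) := sC.
Qed.

(** Let [z] arise from [w] by a column permutation [s], and let $x$ be the largest number moved by
    $s^{-1}$. Then $s^{-1}(x)<x$ lies in the same column of [T], hence in a higher row. So the
    letter at $x$ drops, and later letters are unchanged. *)
Lemma polytabloid_lead T w z : T \in SYT n la -> tabloid_of T =
  word_tabloid w ->
  polytabloid T (word_tabloid z) != 0 -> z = w \/ (word_rank z < word_rank w)%N.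
Proof.
move=> TS; have [g [gT Tg]] := fillings_cancel (SYT_fillings TS).
rewrite (tabloid_ofE gT Tg) => /word_tabloid_inj <-;
  rewrite (polytabloid_word _ gT Tg) => nz.
have /exists_inP[s sC /forallP eqz] :
    [exists s in col_stab T, [forall x, z (s x) == row (g x)]].
  apply: contraR nz; rewrite negb_exists_in => /forall_inP none.
  by rewrite big1 // => s sC; rewrite (negPf (none s sC)) mulr0.
have zE y : z y = row (g (s^-1%g y)) by rewrite -(eqP (eqz _)) permKV.
have [s1|s1] := eqVneq (s^-1)%g 1%g.
  by left; apply/ffunP => y; rewrite zE s1 perm1 ffunE.
right; have /existsP[x0 neq0] : [exists x, s^-1%g x != x].
  apply: contraR s1; rewrite negb_exists => /forallP eqs.
  by apply/eqP/permP => x; apply/eqP; rewrite perm1; have := eqs x;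
    rewrite negbK.
case: (@arg_maxnP _ x0 (fun x => s^-1%g x != x) (fun x : 'I_n => x :
  nat) neq0) => x neqx max_x.
have fix_above (y : 'I_n) : (x < y)%N -> s^-1%g y = y.
  by move=> lt; apply/eqP; apply: contraLR lt; rewrite -leqNgt => /max_x.
have eqc : col (g (s^-1%g x)) = col (g x).
  by move: sC; rewrite -col_stabV => /(col_stabP _ gT Tg)/(_ x).
have lt_sx : (s^-1%g x < x)%N.
  rewrite ltn_neqAle neqx leqNgt; apply/negP => /fix_above /perm_inj eqx.
  by rewrite eqx eqxx in neqx.
apply: (word_rank_ltn (x := x)) => [|y /fix_above fix_y]; last
  by rewrite zE ffunE fix_y.
rewrite zE ffunE ltnNge; apply/negP; rewrite leq_eqVlt => /orP[/eqP eqr|ltr].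
  have /(can_inj Tg) eqx : g (s^-1%g x) = g x.
    by apply: box_inj => //; apply: val_inj; rewrite /= eqr.
  by rewrite eqx eqxx in neqx.
by have := SYT_col TS (esym eqc) ltr; rewrite !Tg ltnNge ltnW.
Qed.

Definition word_set w (x : 'I_n) i : {ffun 'I_n -> 'I_(size la)} :=
  [ffun y => if y == x then i else w y].

Lemma nth_partition (i j : nat) : (i <= j)%N -> (nth 0 la j <= nth 0 la i)%N.
Proof.
have /and3P[la_sorted _ _] := la_part => leij.
have [ltj|gej] := ltnP j (size la); last by rewrite nth_default.
apply: (sorted_leq_nth _ _ 0%N la_sorted) => //; rewrite ?inE //.
- by move=> a b c /= leab leca; apply: leq_trans leca leab.
- by move=> a /=.
- exact: leq_ltn_trans leij ltj.
Qed.

(* For a polytabloid, the transposition of the moved entry with the entry above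
   it in row [r] cancels the terms pairwise. *)
Lemma Specht_move_up v z (r r' : 'I_(size la)) : (r < r')%N -> Specht v ->
  \sum_(x | z x == r) v (word_tabloid (word_set z x r')) = 0.
Proof.
move=> ltr; elim/span_ind => [|a u w u0 w0|T TF].
- by rewrite big1 // => x _; rewrite ffunE.
- under eq_bigr => x _ do rewrite !ffunE.
  by rewrite big_split /= -scaler_sumr u0 w0 scaler0 addr0.
have [g [gT Tg]] := fillings_cancel TF.
under eq_bigr => x _ do rewrite (polytabloid_word _ gT Tg).
rewrite exchange_big /=.
(* Writing the changed number as [s y] allows [y] to be fixed while the terms are paired over
   [s]. *)
pose P y s := (z (s y) == r) && [forall x, word_set z (s y) r' (s x) == row (g
  x)].
rewrite (eq_bigr (fun s => \sum_y (-1) ^+ s * (P y s)%:R)); last first.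
  move=> s _; rewrite (reindex_inj (@perm_inj _ s)) /= big_mkcond.
  by apply: eq_bigr => y _; rewrite /P; case: eqP => _; rewrite ?mulr0.
rewrite exchange_big /=; apply: big1 => y _.
have [eqr|neqr] := eqVneq (row (g y)) r'; last first.
  rewrite big1 // => s _; rewrite /P; have [_|] := eqVneq; last
    by rewrite mulr0.
  case: forallP => [/(_ y)|_]; last by rewrite mulr0.
  by rewrite ffunE eqxx eq_sym (negPf neqr).
(* Row lengths weakly decrease, so the column of [y] also meets row [r]; [y'] is the entry of [T]
   there. *)
have ltc : (col (g y) < nth 0 la r)%N.
  by apply: leq_trans (ltn_col _) _; rewrite eqr nth_partition // ltnW.
pose y' := T (mkbox ltc).
have gy' : g y' = mkbox ltc by rewrite gT.
have rowy' : row (g y') = r by rewrite gy'.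
have coly' : col (g y') = col (g y) by rewrite gy'.
have neqy : y != y' by apply: contraTneq ltr => eqy;
  rewrite -eqr eqy rowy' ltnn.
pose t := tperm y y'.
have tC : t \in col_stab T.
  by apply/(col_stabP _ gT Tg) => x; rewrite /t; case: tpermP => // ->.
have PE s : P y s -> P y (t * s)%g.
  case/andP=> /eqP zy /forallP zE.
  have zE' x : x != y -> z (s x) = row (g x).
    by move=> neqx; have := zE x; rewrite ffunE (inj_eq perm_inj) (negPf neqx)
      => /eqP.
  have ty : t y = y' by rewrite /t tpermL.
  apply/andP; split; first by rewrite permM ty zE' 1?eq_sym // rowy'.
  apply/forallP => x; rewrite ffunE (inj_eq perm_inj).
  have [->|neqx] := eqVneq x y; first by rewrite eqr.
  rewrite permM /t; case: tpermP neqx => [->|-> _|_ _ neqx']; first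
    by rewrite eqxx.
    by rewrite zy rowy'.
  by rewrite zE'.
have PtE s : P y (t * s)%g = P y s.
  by apply/idP/idP => /PE //; rewrite mulgA tperm2 mul1g.
set S := \sum_(s in _) _; have : S = - S.
  rewrite {1}/S (reindex_inj (mulgI t)) -sumrN /=.
  apply: eq_big => [s|s _]; first by rewrite col_stabMl.
  by rewrite PtE odd_permM odd_tperm neqy signr_addb expr1 -mulrA mulN1r.
by move/eqP; rewrite -addr_eq0 -mulr2n mulrn_eq0 => /eqP.
Qed.

(** Suppose [r'] beats [r] among the first [m] letters. Let only the letters [r], [r'] in this
    prefix vary, and record a word by the set of its prefix positions carrying [r']. The relations
    of [Specht_move_up] then say that the up operator kills the resulting function [f], so
    [up_operator_inj] makes the coefficient of [w] vanish. *)
Lemma Specht_lead_ballot v w : Specht v -> v (word_tabloid w) != 0 ->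
    (forall z, (word_rank w < word_rank z)%N -> v (word_tabloid z) = 0) ->
  forall (r r' : 'I_(size la)) (m : nat), (r < r')%N ->
    (#|[set x : 'I_n | (x < m)%N && (w x == r')]| <= #|[set x :
      'I_n | (x < m)%N && (w x == r)]|)%N.
Proof.
move=> Sv nz lead r r' m ltr; rewrite leqNgt; apply: contra nz => gt.
pose P := [set x : 'I_n | (x < m)%N & (w x == r) || (w x == r')].
pose A0 := [set x : 'I_n | (x < m)%N && (w x == r')].
pose word_of (A : {set 'I_n}) : {ffun 'I_n -> 'I_(size la)} :=
  [ffun x => if x \in P then if x \in A then r' else r else w x].
(* Keeping only sets as large as [A0] gives every set in the support the majority of [r'] over
   [r]. *)
pose f (A : {set 'I_n}) : rat :=
  if (A \subset P) && (#|A| == #|A0|) then v (word_tabloid (word_of A)) else 0.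
have subA0 : A0 \subset P.
  by apply/subsetP => x; rewrite !inE => /andP[-> ->]; rewrite orbT.
have word_A0 : word_of A0 = w.
  apply/ffunP => x; rewrite ffunE !inE; case: ltnP => //= _.
  case: eqVneq => [->|_] /=; last by case: eqVneq => [->|].
  by case: eqVneq => // eqr; move: ltr; rewrite eqr ltnn.
have PD0 : P :\: A0 = [set x : 'I_n | (x < m)%N && (w x == r)].
  apply/setP => x; rewrite !inE; case: ltnP => //= _.
  have [->|] //= := eqVneq (w x) r'; last by rewrite orbF.
  by rewrite eq_sym; case: eqVneq => // eqr; move: ltr; rewrite eqr ltnn.
suff f0 : f A0 = 0 by move: f0; rewrite /f subA0 eqxx /= word_A0 => ->.
apply: (up_operator_inj (P := P)) => [A|B].
  rewrite /f; case: ifP => [/andP[subA /eqP cardA] _|]; last by rewrite eqxx.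
  rewrite cardsD (setIidPr subA) cardA.
  by have := gt; rewrite -PD0 cardsD (setIidPr subA0).
have [/andP[subB /eqP cardB]|nB] := boolP ((B \subset P) && (#|B|.+1 ==
  #|A0|)); last first.
  rewrite big1 // => x; rewrite inE => /andP[xB xP]; rewrite /f ifN //.
  apply: contra nB; rewrite subUset cardsU1 xB add1n =>
    /andP[/andP[_ ->] /eqP->].
  by rewrite eqxx.
rewrite -[RHS](Specht_move_up (word_of B) ltr Sv) [RHS](bigID (mem P)) /=.
rewrite [X in _ = _ + X]big1 ?addr0.
  apply: eq_big => x.
    rewrite !inE ffunE; case: (boolP (x \in P)) => [xP|]; last first.
      by rewrite inE => /negPf->; rewrite !andbF.
    have := xP; rewrite inE => ->; rewrite !andbT; case: (x \in B);
      rewrite ?eqxx //=.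
    by case: eqVneq => // eqr; move: ltr; rewrite eqr ltnn.
  rewrite inE => /andP[xB xP]; rewrite /f subUset sub1set xP subB cardsU1 xB
    add1n cardB eqxx /=.
  congr (v (word_tabloid _)); apply/ffunP => y; rewrite !ffunE in_setU1.
  by case: (eqVneq y x) => [->|//]; rewrite xP.
(* The remaining terms change a letter [r] to [r'] beyond the prefix, which yields a word above the
   leading one. *)
move=> x /andP[zx xP]; apply: lead.
have wx : w x = r by move: zx; rewrite ffunE (negPf xP) => /eqP.
have lemx : (m <= x)%N.
  by move: xP; rewrite inE wx eqxx /= andbT -leqNgt.
apply: (word_rank_ltn (x := x)); first by rewrite ffunE eqxx wx.
move=> y lty; rewrite !ffunE ifN ?ifN //.
  by rewrite inE negb_and -leqNgt (leq_trans lemx (ltnW lty)).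
by apply: contraTneq lty => ->; rewrite ltnn.
Qed.

End LeadingWord.

(** * The basis of standard polytabloids *)

Section StandardBasis.

Variables (n : nat) (la : seq nat).
Hypothesis la_part : is_partition n la.
Implicit Types (T U : {ffun box la -> 'I_n}) (s t : 'S_n).
Implicit Types (v : tabloid_module n la) (w z : {ffun 'I_n -> 'I_(size la)}).

Lemma sumn_partition : sumn la = n.
Proof. by have /and3P[_ _ /eqP] := la_part. Qed.

(** Along a row of a standard tableau the entries to the left of [x] are exactly the smaller ones.
    Thus the row word alone determines the tableau. *)
Lemma SYT_col_count T g : T \in SYT n la -> cancel T g -> cancel g T ->
  forall x, col (g x) = #|[set y : 'I_n | (y < x)%N && (row (g y) == row (g
    x))]|.
Proof.
move=> TS gT Tg x; rewrite -[LHS](card_row_below (ltnW (ltn_col (g x)))).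
rewrite -(card_imset _ (can_inj gT)); apply: eq_card => y; rewrite inE.
apply/imsetP/andP => [[b]|[ltyx /eqP eqr]].
  rewrite inE => /andP[/eqP rb cb] ->; rewrite gT rb; split=> //.
  by rewrite -[x]Tg (SYT_row TS).
exists (g y); rewrite ?Tg // inE eqr eqxx ltnNge; apply/negP.
rewrite leq_eqVlt => /orP[/eqP eqc|ltc].
  have /(can_inj Tg) eqxy : g x = g y by apply: box_inj.
  by rewrite eqxy ltnn in ltyx.
by have := SYT_row TS (esym eqr) ltc; rewrite !Tg ltnNge (ltnW ltyx).
Qed.

Lemma SYT_tabloid_inj : {in SYT n la &, injective (@tabloid_of n la)}.
Proof.
move=> T U TS US; have [g [gT Tg]] := fillings_cancel (SYT_fillings TS).
have [h [hU Uh]] := fillings_cancel (SYT_fillings US).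
rewrite (tabloid_ofE gT Tg) (tabloid_ofE hU Uh) => /word_tabloid_inj/ffunP eqr.
have {}eqr x : row (g x) = row (h x) by have := eqr x; rewrite !ffunE.
have eqgh x : g x = h x.
  apply: box_inj => //; rewrite (SYT_col_count TS gT Tg) (SYT_col_count US hU
    Uh).
  by apply: eq_card => y; rewrite !inE !eqr.
by apply/ffunP => b; rewrite -[RHS]Tg eqgh hU.
Qed.

(* The entry [x] goes to row [w x], at the end of the entries smaller than [x]
   in that row; the ballot condition makes the columns increase. *)
Lemma ballot_SYT w :
    (forall i, #|[set x | w x == i]| = nth 0%N la i) ->
    (forall (r r' : 'I_(size la)) (m : nat), (r < r')%N ->
      #|[set x : 'I_n | (x < m)%N && (w x == r')]| <= #|[set x :
        'I_n | (x < m)%N && (w x == r)]|)%N ->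
  exists2 T, T \in SYT n la & tabloid_of T = word_tabloid w.
Proof.
move=> content ballot.
pose before (x : 'I_n) i := [set y : 'I_n | (y < x)%N && (w y == i)].
have lt_before x : (#|before x (w x)| < nth 0 la (w x))%N.
  rewrite -content proper_card //; apply/properP; split.
    by apply/subsetP => y; rewrite !inE => /andP[].
  by exists x; rewrite !inE ?eqxx // ltnn.
have before_lt (x y : 'I_n) : (x < y)%N -> w x = w y ->
  (#|before x (w x)| < #|before y (w y)|)%N.
  move=> ltxy eqw; rewrite proper_card //; apply/properP; split.
    by apply/subsetP => a; rewrite !inE eqw => /andP[/ltn_trans/(_ ltxy)-> ->].
  by exists x; rewrite !inE ?ltnn // ltxy eqw eqxx.
pose g x := mkbox (lt_before x).
have row_g x : row (g x) = w x by [].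
have col_g x : col (g x) = #|before x (w x)| by [].
have g_inj : injective g.
  move=> x y eqg; have eqw : w x = w y by rewrite -!row_g eqg.
  have eqc : #|before x (w x)| = #|before y (w y)| by rewrite -!col_g eqg.
  apply: val_inj => /=; case: (ltngtP x y) => // lt.
    by have := before_lt _ _ lt eqw; rewrite eqc ltnn.
  by have := before_lt _ _ lt (esym eqw); rewrite eqc ltnn.
have [h gh hg] : bijective g.
  by apply: inj_card_bij g_inj _; rewrite card_box sumn_partition card_ord.
pose T : {ffun box la -> 'I_n} := [ffun b => h b].
have gT : cancel T g by move=> b; rewrite ffunE hg.
have Tg : cancel g T by move=> x; rewrite ffunE gh.
exists T; last first.
  by rewrite (tabloid_ofE gT Tg); congr word_tabloid; apply/ffunP => x;
    rewrite ffunE.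
rewrite inE bij_fillings /=; last by exists g.
apply/forallP => b; apply/forallP => c; rewrite -[b]gT -[c]gT !Tg !row_g !col_g.
move: (T b) (T c) => x y; apply/andP; split; apply/implyP =>
  /andP[/eqP eqxy lt].
  rewrite ltnNge; apply/negP; rewrite leq_eqVlt => /orP[/eqP/val_inj eqyx|ltyx].
    by rewrite eqyx ltnn in lt.
  by have := before_lt _ _ ltyx (esym eqxy); rewrite ltnNge ltnW.
rewrite ltnNge; apply/negP => leyx.
(* The prefix ending with [y] counts [y] itself, hence one letter [w y] more than [before y (w y)],
   while its letters [w x] all come before [x]. *)
have := ballot _ _ y.+1 lt; rewrite leqNgt => /negP; apply.
have -> : [set a : 'I_n | (a < y.+1)%N && (w a == w y)] = y |: before y (w y).
  apply/setP => a; rewrite !inE ltnS leq_eqVlt.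
  by rewrite -[a == y](inj_eq val_inj) /=; case: eqVneq => [/val_inj->|_];
    rewrite ?eqxx.
rewrite cardsU1 inE ltnn add1n ltnS -eqxy subset_leq_card //.
apply/subsetP => a; rewrite !inE ltnS => /andP[leay /eqP wa];
  rewrite wa eqxx andbT.
rewrite ltn_neqAle (leq_trans leay leyx) andbT; apply: contraTneq lt => eqax.
have -> : y = x by apply/val_inj/eqP; rewrite /= eqn_leq leyx -eqax.
by rewrite ltnn.
Qed.

Lemma tabloid_of_word T : T \in fillings n la -> exists w, tabloid_of T =
  word_tabloid w.
Proof. by case/fillings_cancel=> g [gT Tg]; exists [ffun x => row (g x)];
  apply: tabloid_ofE. Qed.

(** The rank of the underlying word, with the dummy value 0 for families that come from no word. *)
Definition tabloid_rank (u : tabloid n la) : nat :=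
  oapp (@word_rank n la) 0%N [pick w | word_tabloid w == u].

Lemma tabloid_rank_word w : tabloid_rank (word_tabloid w) = word_rank w.
Proof.
rewrite /tabloid_rank; case: pickP => [z /eqP/word_tabloid_inj -> //|/(_ w)].
by rewrite eqxx.
Qed.


(** Among the tableaux with nonzero coefficient take [T1] of maximal rank. Another polytabloid
    involving the tabloid of [T1] would have a larger leading word or the same one; maximality
    excludes the former, [SYT_tabloid_inj] the latter. *)
Lemma polytabloid_SYT_free (c : {ffun box la -> 'I_n} -> rat) :
  \sum_(T in SYT n la) c T *: polytabloid T = 0 ->
    forall T, T \in SYT n la -> c T = 0.
Proof.
move=> sum0 T0 T0S; apply/eqP; apply: contraT => nz0.
pose Q T := (T \in SYT n la) && (c T != 0).
have QT0 : Q T0 by apply/andP.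
case: (@arg_maxnP _ T0 Q (fun T => tabloid_rank (tabloid_of T)) QT0) =>
  T1 /andP[T1S nz1] max1.
have := congr1 (fun v : tabloid_module n la => v (tabloid_of T1)) sum0.
rewrite sum_ffunE (bigD1 T1) //= !ffunE polytabloid_self ?SYT_fillings // big1.
  by rewrite addr0 [LHS]mulr1 => c1; rewrite c1 eqxx in nz1.
move=> T /andP[TS neq]; rewrite ffunE; apply/eqP; apply: contraT => nz.
have [w1 ew1] := tabloid_of_word (SYT_fillings T1S).
have [w ew] := tabloid_of_word (SYT_fillings TS).
move: nz; rewrite mulf_eq0 negb_or => /andP[cT]; rewrite ew1 =>
  /(polytabloid_lead TS ew)[eqw|].
  by case/eqP: neq; apply: SYT_tabloid_inj; rewrite // ew1 eqw ew.
have QT : Q T by apply/andP.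
by have := max1 T QT; rewrite ew1 ew !tabloid_rank_word /= => le;
  rewrite ltnNge le.
Qed.

Lemma Specht_lead_SYT v w : Specht v -> v (word_tabloid w) != 0 ->
    (forall z, (word_rank w < word_rank z)%N -> v (word_tabloid z) = 0) ->
  exists2 T, T \in SYT n la & tabloid_of T = word_tabloid w.
Proof.
move=> Sv nz lead; apply: ballot_SYT; last exact:
  (Specht_lead_ballot la_part Sv nz lead).
have [T TF eqw] := Specht_supp Sv nz; have [g [gT Tg]] := fillings_cancel TF.
move: eqw; rewrite (tabloid_ofE gT Tg) => /word_tabloid_inj -> i.
rewrite -card_row -(card_imset _ (can_inj gT)); apply: eq_card => x;
  rewrite inE ffunE.
apply/idP/imsetP => [rx|[b /[swap] ->]]; last by rewrite inE gT.
by exists (g x); rewrite ?inE ?Tg.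
Qed.

(** Induction on a strict bound for the ranks in the support: if a word reaches the top rank, it is
    the leading word of a standard polytabloid, and subtracting a multiple of that polytabloid
    lowers the bound. *)
Lemma Specht_span_SYT v : Specht v -> Defs.span (SYT n la) (@polytabloid n la)
  v.
Proof.
have [m] : exists m, forall w, v (word_tabloid w) != 0 -> (word_rank w < m)%N.
  exists (\max_(w : {ffun 'I_n -> 'I_(size la)}) word_rank w).+1 => w _;
    rewrite ltnS; exact: leq_bigmax.
elim: m v => [|m IH] v bound Sv.
  suff -> : v = 0 by apply: span0.
  apply/ffunP => u; rewrite ffunE; apply/eqP; apply: contraT => nz.
  have [T TF eqT] := Specht_supp Sv nz; have [w eqw] := tabloid_of_word TF.
  by have := bound w; rewrite -eqw -eqT => /(_ nz).
have [/existsP[w /andP[nz /eqP rank_w]]|none] :=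
  boolP [exists w, (v (word_tabloid w) != 0) && (word_rank w == m)]; last first.
  apply: IH Sv => w nz; have := bound w nz; rewrite ltnS leq_eqVlt =>
    /orP[rank_w|//].
  by case/existsP: none; exists w; rewrite nz.
have lead z : (word_rank w < word_rank z)%N -> v (word_tabloid z) = 0.
  rewrite rank_w => lt; apply/eqP; apply: contraT => /bound.
  by rewrite ltnS leqNgt lt.
have [T TS eqT] := Specht_lead_SYT Sv nz lead.
pose a := v (word_tabloid w); have -> : v = a *: polytabloid T + (v - a *:
  polytabloid T).
  by rewrite addrC subrK.
apply: span_linear; first exact: mem_span.
have STF : Specht (polytabloid T) by apply/mem_span/SYT_fillings.
apply: IH => [z|]; last by rewrite addrC -scaleNr; apply: span_linear.
rewrite ltn_neqAle => nz'; have [eqz|neqz] := eqVneq z w.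
  have := polytabloid_self (SYT_fillings TS); rewrite eqT => eT1.
  by move: nz'; rewrite eqz !ffunE eT1 [a *: _]mulr1 subrr eqxx.
have [/(polytabloid_lead TS eqT)[eqz|]|/negPn/eqP eT0] :=
  boolP (polytabloid T (word_tabloid z) != 0).
- by rewrite eqz eqxx in neqz.
- by rewrite rank_w => lt; rewrite ltn_eqF //= ltnW.
have vz : v (word_tabloid z) != 0.
  by move: nz'; rewrite !ffunE eT0 scaler0 subr0.
rewrite -ltnS (bound z vz) andbT; apply: contraNneq neqz => rank_z.
by apply/eqP/word_rank_inj; rewrite rank_z.
Qed.

Lemma polytabloid_SYT_basis : is_basis (@Specht n la) (SYT n la) (@polytabloid
  n la).
Proof.
split=> [v|]; last exact: polytabloid_SYT_free.
split=> [|[c ->]]; first exact: Specht_span_SYT.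
exists (fun T => if T \in SYT n la then c T else 0).
rewrite big_mkcond [RHS]big_mkcond /=; apply: eq_bigr => T _.
case: ifP => [TS|]; last by rewrite scale0r if_same.
by rewrite (SYT_fillings TS).
Qed.

End StandardBasis.

(** * Transfer of basis and irreducibility from the Specht module to $V_M$ *)

Theorem theorem2p10 (n : nat) (la : seq nat) (hla : is_partition n la)
    (M : {ffun box la -> nat}) (hM : is_ssyt M) :
  [/\ is_basis (VM (n := n) M) (SYT n la) (fun T => FMT M T),
      irreducible_rep (fun s : 'S_n => msym s) (VM (n := n) M),
      (forall p : {mpoly rat[n]}, VM M p -> p \is (entry_sum M).-homog)
    & isomorphic_rep (fun s : 'S_n => msym s) (VM (n := n) M)
        (@tabloid_module_act n la) (@Specht n la)].
Proof.
have [T0 T0F] := fillings_exist (sumn_partition hla).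
(* The scalar is taken from one filling [T0]; by [sMT_act] it is the right one for all fillings. *)
pose th : {linear tabloid_module n la -> {mpoly rat[n]}} :=
  specht_to_poly M (sMT M T0)%:R^-1.
have thF T : T \in fillings n la -> th (polytabloid T) = FMT M T.
  move=> TF; rewrite -specht_to_poly_polytabloid // /th.
  by have [s ->] := fillings_trans T0F TF; rewrite sMT_act.
have th_sum (A : {set {ffun box la -> 'I_n}}) (c : {ffun box la -> 'I_n} ->
  rat) :
    A \subset fillings n la ->
    th (\sum_(T in A) c T *: polytabloid T) = \sum_(T in A) c T *: FMT M T.
  move=> /subsetP subA; rewrite linear_sum /=; apply: eq_bigr => T TA.
  by rewrite linearZ /= thF // subA.
have subS : SYT n la \subset fillings n la by apply/subsetP => T; apply:
  SYT_fillings.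
have th_act s v : th (tabloid_module_act s v) = msym s (th v) by apply:
  specht_to_poly_act.
have VMP p : VM M p <-> exists2 v, Specht v & th v = p.
  split=> [[c ->]|[v [c ->] <-]]; last by exists c; rewrite th_sum.
  by exists (\sum_(T in fillings n la) c T *: polytabloid T);
    [exists c|rewrite th_sum].
have [S0 Slin Sact] := Specht_subrep n la.
have th0 v : Specht v -> th v = 0 -> v = 0.
  (* The kernel of [th] in the Specht module is a subrepresentation; it is not everything because
     $F_{M,T_0}\neq 0$. *)
  pose K v := Specht v /\ th v = 0.
  have [||KS|SK] := @Specht_subrep_dichotomy n la K.
  - split=> [|a u w [Su u0] [Sw w0]|s u [Su u0]]; first by split;
    rewrite ?linear0.
      by split; [apply: Slin | rewrite linearP /= u0 w0 scaler0 addr0].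
    by split; [apply: Sact | rewrite th_act u0 linear0].
  - by move=> u [].
  - by move=> Sv v0; apply: KS.
  have /SK[_] : Specht (polytabloid T0) by apply: mem_span.
  by rewrite thF // => /eqP; rewrite (negPf (FMT_neq0 hM T0F)).
have th_inj u v : Specht u -> Specht v -> th u = th v -> u = v.
  move=> Su Sv eqth; apply/eqP; rewrite -subr_eq0; apply/eqP/th0.
    by rewrite -scaleN1r addrC; apply: Slin.
  by rewrite linearB /= eqth subrr.
have [Sspan Sfree] := polytabloid_SYT_basis hla.
have VM_sub : subrep (fun s : 'S_n => msym s) (VM (n := n) M).
  split=> [|a p q /VMP[u Su <-] /VMP[v Sv <-]|s p /VMP[u Su <-]].
  - by apply/VMP; exists 0; rewrite ?linear0.
  - by apply/VMP; exists (a *: u + v); [apply: Slin | rewrite linearP].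
  - by apply/VMP; exists (tabloid_module_act s u); [apply: Sact |].
split.
- split=> [p|c sum0 T TS].
    split=> [/VMP[v /Sspan[c ->] <-]|[c ->]]; first by exists c; rewrite th_sum.
    rewrite -th_sum //; apply/VMP; exists (\sum_(T in SYT n la) c T *:
      polytabloid T) => //.
    by apply/Sspan; exists c.
  apply: Sfree TS; apply: th0; last by rewrite th_sum.
  by apply/Sspan; exists c.
- split=> //.
    exists (FMT M T0); first exact: mem_span.
    by apply/eqP; apply: FMT_neq0.
  move=> U [U0 Ulin Uact] UV.
  (* Irreducibility is pulled back along [th]: the preimage of [U] is a subrepresentation of the
     Specht module. *)
  pose W v := Specht v /\ U (th v).
  have [||W0|SW] := @Specht_subrep_dichotomy n la W.
  - split=> [|a u w [Su Uu] [Sw Uw]|s u [Su Uu]]; first by split;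
    rewrite ?linear0.
      by split; [apply: Slin | rewrite linearP; apply: Ulin].
    by split; [apply: Sact | rewrite th_act; apply: Uact].
  - by move=> u [].
  - left=> p Up; have /VMP[v Sv eqp] := UV p Up.
    by rewrite -eqp (W0 v) ?linear0 //; split; rewrite // eqp.
  by right=> p /VMP[v /SW[_ Uv] <-].
- move=> p /VMP[v _ <-]; apply: rpredZ; apply: rpred_sum => T TF.
  by apply: rpredZ; apply: pMT_homog.
(* The isomorphism has to go from $V_M$ to the Specht module and be defined on all polynomials, so
   it is the inverse of [th] obtained by choice, with unspecified values outside $V_M$. *)
pose f p := epsilon (inhabits 0) (fun v => Specht v /\ th v = p).
have fP p : VM M p -> Specht (f p) /\ th (f p) = p.
  move=> /VMP[v Sv eqp].
  exact: (epsilon_spec (inhabits 0) (fun v => Specht v /\ th v =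
    p) (ex_intro _ v (conj Sv eqp))).
have [_ VMlin VMact] := VM_sub.
exists f; split.
- move=> a p q Vp Vq; have [Sp ep] := fP p Vp; have [Sq eq] := fP q Vq.
  have [Sr er] := fP _ (VMlin a p q Vp Vq).
  by apply: th_inj => //; [apply: Slin | rewrite er linearP /= ep eq].
- move=> s p Vp; have [Sp ep] := fP p Vp; have [Sr er] := fP _ (VMact s p Vp).
  by apply: th_inj => //; [apply: Sact | rewrite er th_act ep].
- by move=> p q /fP[_ {2}<-] /fP[_ {2}<-] ->.
move=> v; split=> [Sv|[p /fP[Sp _] <- //]].
have Vv : VM M (th v) by apply/VMP; exists v.
by exists (th v) => //; have [Sr er] := fP _ Vv; apply: th_inj.
Qed.
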